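(* Let $v_1=(x_1,y_1,z_1)$ and $v_2=(x_2,y_2,z_2)$ be distinct points of $\mathbb{Z}^3$, let $d\ge d(v_1,v_2)$ be an integer, $\delta=d-d(v_1,v_2)$, and let ${\cal A}_d(v_1,v_2)$ be the optimal tristance anticode in ${\cal G}_3$ of diameter $d$ centered about $v_1$ and $v_2$. Let $x_{\max}=\max\{x_1,x_2\}$, $x_{\min}=\min\{x_1,x_2\}$, and define $y_{\max},y_{\min},z_{\max},z_{\min}$ similarly. Then ${\cal A}_d(v_1,v_2)$ consists of all $(x,y,z)\in\mathbb{Z}^3$ such that $x_{\min}-\delta\le x\le x_{\max}+\delta$; $y_{\min}-\delta\le y\le y_{\max}+\delta$; $z_{\min}-\delta\le z\le z_{\max}+\delta$; $x_{\min}+y_{\min}-\delta\le x+y\le x_{\max}+y_{\max}+\delta$; $x_{\min}-y_{\max}-\delta\le x-y\le x_{\max}-y_{\min}+\delta$; $x_{\min}+z_{\min}-\delta\le x+z\le x_{\max}+z_{\max}+\delta$; $x_{\min}-z_{\max}-\delta\le x-z\le x_{\max}-z_{\min}+\delta$; $y_{\min}+z_{\min}-\delta\le y+z\le y_{\max}+z_{\max}+\delta$; $y_{\min}-z_{\max}-\delta\le y-z\le y_{\max}-z_{\min}+\delta$; $x_{\min}+y_{\min}+z_{\min}-\delta\le x+y+z\le x_{\max}+y_{\max}+z_{\max}+\delta$; $x_{\min}-y_{\max}+z_{\min}-\delta\le x-y+z\le x_{\max}-y_{\min}+z_{\max}+\delta$; $x_{\min}+y_{\min}-z_{\max}-\delta\le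 x+y-z\le x_{\max}+y_{\max}-z_{\min}+\delta$; $x_{\min}-y_{\max}-z_{\max}-\delta\le x-y-z\le x_{\max}-y_{\min}-z_{\min}+\delta$.
   Context: The grid graph ${\cal G}_3$ has vertex set $\mathbb{Z}^3$, two points being adjacent iff their $L_1$-distance $d(\cdot,\cdot)$ is $1$. For $v,v',v''\in\mathbb{Z}^3$, the tristance $d_3(v,v',v'')$ is the minimum number of edges of a tree in ${\cal G}_3$ (possibly using additional vertices) containing them. A set ${\cal A}\subset\mathbb{Z}^3$ is a tristance anticode of diameter $d$ centered about $v_1,v_2$ if $d_3(v_1,v_2,v)\le d$ for all $v\in{\cal A}$; it is optimal if it has largest possible cardinality among such sets. *)

(* Defs.v *)
From HB Require Import structures.
From mathcomp Require Import all_boot all_order all_algebra.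
From mathcomp Require Import finmap.
From mathcomp Require Import boolp classical_sets functions cardinality.

Set Implicit Arguments.
Unset Strict Implicit.
Unset Printing Implicit Defensive.

Import Order.TTheory GRing.Theory Num.Theory.
Local Open Scope ring_scope.
Local Open Scope classical_set_scope.

Section Trees.
Variables (T : choiceType) (adj : rel T).
Implicit Types (V : {fset T}) (E : {fset {fset T}}).

(* The edge joining u and v is the unordered pair [fset u; v]. *)
Definition joined E : rel T := fun u v => [fset u; v]%fset \in E.

Definition is_subgraph V E : Prop :=
  forall e, e \in E ->
    exists u v, [/\ u \in V, v \in V, adj u v & e = [fset u; v]%fset].

Definition is_connected V E : Prop :=
  forall u v, u \in V -> v \in V ->
    exists2 p : seq T, path (joined E) u p & last u p = v.

(* The bound on the size discards the "cycle" that traverses a single edge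
   back and forth. *)
Definition is_acyclic E : Prop :=
  forall c : seq T, (2 < size c)%N -> ~ ucycle (joined E) c.

Definition is_tree V E : Prop :=
  [/\ V != fset0, is_subgraph V E, is_connected V E & is_acyclic E].

End Trees.

Definition Z3 : Type := (int * int * int)%type.

Definition L1dist (p q : Z3) : int :=
  `|p.1.1 - q.1.1| + `|p.1.2 - q.1.2| + `|p.2 - q.2|.

Definition grid_adj : rel Z3 := fun p q => L1dist p q == 1.

Definition connecting_tree_size (u v w : Z3) : set nat :=
  [set n | exists (V : {fset Z3}) (E : {fset {fset Z3}}),
     [/\ is_tree grid_adj V E, u \in V, v \in V, w \in V & #|` E|%fset = n]].

(* The minimum of connecting_tree_size u v w; the default value 0 is never used,
   since the grid is connected. *)
Definition tristance (u v w : Z3) : nat :=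
  xget 0%N [set n | connecting_tree_size u v w n /\
    forall m, connecting_tree_size u v w m -> (n <= m)%N].

Definition tristance_anticode (d : int) (v1 v2 : Z3) (A : set Z3) : Prop :=
  forall v, A v -> (tristance v1 v2 v)%:Z <= d.

(* Cardinalities are compared by injections, so that no finiteness of
   anticodes is presupposed. *)
Definition optimal_anticode (d : int) (v1 v2 : Z3) (A : set Z3) : Prop :=
  tristance_anticode d v1 v2 A /\
  forall B : set Z3, tristance_anticode d v1 v2 B -> (B #<= A)%card.

(* Main.v *)
(* The tristance of three points is the sum over the axes of the spread
   (max - min) of their coordinates.  A tree of at most that size is grown leaf
   by leaf from the coordinatewise median.  Conversely, a connected subgraph
   containing the points has, for each axis and each consecutive pair of levels
   k, k + 1 in the spread, an edge joining these levels, and a grid edge does so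
   for a single axis and a single k.  Hence d_3(v1, v2, v) - d(v1, v2) is the L1
   distance from v to the bounding box of v1 and v2; the points with this
   distance at most delta form a finite anticode containing every other one, and
   the 26 inequalities spell out the L1 ball condition sign by sign. *)
Require Import Defs.
From HB Require Import structures.
From mathcomp Require Import all_boot all_order all_algebra.
From mathcomp Require Import finmap.
From mathcomp Require Import zify.
From mathcomp Require Import boolp classical_sets functions cardinality.

Import Order.TTheory GRing.Theory Num.Theory.
Local Open Scope ring_scope.
Local Open Scope classical_set_scope.

(** * Adding a leaf to a tree *)

Section Trees.
Variables (T : choiceType) (adj : rel T).
Implicit Types (V : {fset T}) (E : {fset {fset T}}).

Lemma fset2C (u v : T) : [fset u; v]%fset = [fset v; u]%fset.
Proof. by apply/fsetP => x; rewrite !inE orbC. Qed.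

Lemma tree_fset1 (u : T) : is_tree adj [fset u]%fset fset0.
Proof.
split.
- by apply/eqP => /fsetP/(_ u); rewrite !inE eqxx.
- by move=> e; rewrite inE.
- by move=> x y; rewrite !inE => /eqP-> /eqP->; exists [::].
- by case=> [|x [|y c]] // _; rewrite /ucycle /= /joined in_fset0.
Qed.

Lemma subgraph_fsetU1 V E u w : u \in V -> adj u w -> is_subgraph adj V E ->
  is_subgraph adj (w |` V)%fset ([fset u; w] |` E)%fset.
Proof.
move=> uV uw sub e; rewrite in_fset1U => /orP[/eqP->|/sub[a [b [aV bV ab ->]]]].
  by exists u, w; rewrite !in_fset1U eqxx uV orbT.
by exists a, b; rewrite !in_fset1U aV bV !orbT.
Qed.

Lemma connected_fsetU1 V E u w : u \in V -> is_connected V E ->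
  is_connected (w |` V)%fset ([fset u; w] |` E)%fset.
Proof.
move=> uV con.
have mono a p : path (joined E) a p -> path (joined ([fset u; w] |` E)%fset) a p.
  by apply: sub_path => b c; rewrite /joined in_fset1U => ->; rewrite orbT.
have uw : joined ([fset u; w] |` E)%fset u w by rewrite /joined fset1U1.
have wu : joined ([fset u; w] |` E)%fset w u by rewrite /joined fset2C fset1U1.
move=> a b; rewrite !in_fset1U => /orP[/eqP->|aV] /orP[/eqP->|bV].
- by exists [::].
- have [p up lp] := con u b uV bV; exists (u :: p) => //=.
  by rewrite wu mono.
- have [p ap lp] := con a u aV uV; exists (rcons p w); last by rewrite last_rcons.
  by rewrite rcons_path mono // lp uw.
- by have [p ap lp] := con a b aV bV; exists p => //; apply: mono.
Qed.

(* In a cycle through the leaf w, both neighbours of w are u. *)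
Lemma acyclic_fsetU1 V E u w : u \in V -> w \notin V -> is_subgraph adj V E ->
  is_acyclic E -> is_acyclic ([fset u; w] |` E)%fset.
Proof.
move=> uV wV sub acyc c c2 cyc.
have joined_w a : joined ([fset u; w] |` E)%fset w a -> a = u.
  rewrite /joined in_fset1U => /orP[/eqP eq_e|/sub[p [q [pV qV _ eq_e]]]].
    have : u \in [fset w; a]%fset by rewrite eq_e !inE eqxx.
    by rewrite !inE => /orP[/eqP uw|/eqP->//]; rewrite -uw uV in wV.
  have : w \in [fset p; q]%fset by rewrite -eq_e !inE eqxx.
  by rewrite !inE => /orP[]/eqP eq_w; rewrite eq_w ?pV ?qV in wV.
have joinedC a b : joined ([fset u; w] |` E)%fset a b =
    joined ([fset u; w] |` E)%fset b a by rewrite /joined fset2C.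
have [wc|wc] := boolP (w \in c).
  (* Rotated to start at [w], the cycle reads [w :: a :: rcons s b]; then [a] and [b] both equal
     [u], against uniqueness. *)
  move: cyc c2; rewrite -(rot_ucycle (index w c)) -(size_rot (index w c)).
  rewrite rot_index //; move: (_ ++ _) => s.
  case: s => [|a s] //; case/lastP: s => [|s b] // /andP[] /=.
  rewrite rcons_path last_rcons (joinedC b) => /andP[/joined_w-> /andP[_ /joined_w->]].
  by rewrite mem_rcons in_cons eqxx /= andbF.
move/andP: cyc => [cyc uc]; apply: (acyc c) => //; rewrite /ucycle uc andbT.
(* A cycle avoiding [w] uses only edges of [E]. *)
apply: (sub_in_cycle (P := predC1 w)) cyc; last first.
  by apply/allP => x xc /=; apply: contraNneq wc => <-.
move=> x y /= xw yw; rewrite /joined in_fset1U => /orP[/eqP eq_e|//].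
have : w \in [fset x; y]%fset by rewrite eq_e !inE eqxx orbT.
by rewrite !inE eq_sym (negPf xw) eq_sym (negPf yw).
Qed.

Lemma tree_fsetU1 V E u w : u \in V -> w \notin V -> adj u w ->
  is_tree adj V E -> is_tree adj (w |` V)%fset ([fset u; w] |` E)%fset.
Proof.
move=> uV wV uw [V0 sub con acyc]; split.
- by apply/eqP => /fsetP/(_ w); rewrite in_fset1U eqxx inE.
- exact: subgraph_fsetU1.
- exact: connected_fsetU1.
- exact: (acyclic_fsetU1 V).
Qed.

End Trees.

(** * Upper bound: growing trees in the grid *)

Lemma L1dist_eq0 (u v : Z3) : L1dist u v = 0 -> u = v.
Proof.
case: u v => [[a b] c] [[a' b'] c']; rewrite /L1dist /= => h.
have -> : a = a' by lia.
have -> : b = b' by lia.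
by have -> : c = c' by lia.
Qed.

(** Moving [w] one unit towards [u], along the first axis where they differ, gives [w']. *)
Lemma L1dist_pred (n : nat) (u w : Z3) : L1dist u w = n.+1 ->
  exists2 w', L1dist u w' = n & grid_adj w' w.
Proof.
case: u w => [[a b] c] [[a' b'] c']; rewrite /grid_adj /L1dist /= => h.
have [aa'|aa'] := eqVneq a a'; last first.
  exists ((if a < a' then a' - 1 else a' + 1), b', c') => /=; first by case: ifP; lia.
  by apply/eqP; case: ifP; lia.
have [bb'|bb'] := eqVneq b b'; last first.
  exists (a', (if b < b' then b' - 1 else b' + 1), c') => /=; first by case: ifP; lia.
  by apply/eqP; case: ifP; lia.
exists (a', b', (if c < c' then c' - 1 else c' + 1)) => /=; first by case: ifP; lia.
by apply/eqP; case: ifP; lia.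
Qed.

(** Induction on the distance: first reach a neighbour [w'] of [w] that is closer to [u], then hang
    [w] from it as a leaf. Nothing is added if [w] is already reached, hence an inequality. *)
Lemma tree_extend (V : {fset Z3}) (E : {fset {fset Z3}}) (u w : Z3) :
  is_tree grid_adj V E -> u \in V ->
  exists (V' : {fset Z3}) (E' : {fset {fset Z3}}),
    [/\ is_tree grid_adj V' E', (V `<=` V')%fset, w \in V'
      & (#|` E'|%fset)%:Z <= (#|` E|%fset)%:Z + L1dist u w].
Proof.
move=> tVE uV.
have [n] : exists n : nat, L1dist u w = n.
  by exists `|L1dist u w|%N; rewrite /L1dist; lia.
elim: n w => [|n IH] w duw.
  by exists V, E; rewrite -(L1dist_eq0 _ _ duw) uV fsubset_refl /L1dist; split=> //; lia.
have [w' duw' w'w] := L1dist_pred _ _ _ duw.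
have [V' [E' [tV'E' VV' w'V' le]]] := IH w' duw'.
rewrite duw' in le; rewrite duw.
have [wV'|wV'] := boolP (w \in V').
  by exists V', E'; split=> //; lia.
exists (w |` V')%fset, ([fset w'; w] |` E')%fset; split.
- exact: tree_fsetU1.
- exact: fsubset_trans VV' (fsubsetUr _ _).
- exact: fset1U1.
- by rewrite cardfsU1; case: (_ \notin _); lia.
Qed.

Definition spread (a b c : int) : int :=
  Num.max a (Num.max b c) - Num.min a (Num.min b c).

Definition total_spread (u v w : Z3) : int :=
  spread u.1.1 v.1.1 w.1.1 + spread u.1.2 v.1.2 w.1.2 + spread u.2 v.2 w.2.

(** This clamps [c] to the interval between [a] and [b]. *)
Definition median (a b c : int) : int :=
  Num.max (Num.min a b) (Num.min (Num.max a b) c).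

Lemma spread_median a b c :
  spread a b c = `|median a b c - a| + `|median a b c - b| + `|median a b c - c|.
Proof. rewrite /spread /median; lia. Qed.

Lemma connecting_tree_le_spread (u v w : Z3) : exists n : nat,
  connecting_tree_size u v w n /\ n%:Z <= total_spread u v w.
Proof.
pose m : Z3 :=
  (median u.1.1 v.1.1 w.1.1, median u.1.2 v.1.2 w.1.2, median u.2 v.2 w.2).
have mm : m \in [fset m]%fset by rewrite inE.
have [V1 [E1 [t1 /fsubsetP s1 u1 c1]]] := tree_extend _ _ m u (tree_fset1 _ _ m) mm.
have [V2 [E2 [t2 /fsubsetP s2 v2 c2]]] := tree_extend _ _ m v t1 (s1 _ mm).
have [V3 [E3 [t3 /fsubsetP s3 w3 c3]]] := tree_extend _ _ m w t2 (s2 _ (s1 _ mm)).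
exists #|` E3|%fset; split.
  by exists V3, E3; split=> //; [apply/s3/s2 | apply: s3].
rewrite /total_spread !spread_median.
move: c1 c2 c3; rewrite cardfs0 /L1dist /=; lia.
Qed.

(** * Lower bound: counting crossed levels *)

Definition coord (i : nat) (p : Z3) : int := nth p.2 [:: p.1.1; p.1.2] i.

(* l = (i, k) stands for the gap between levels k and k + 1 of axis i. *)
Definition crosses (l : nat * int) (e : {fset Z3}) : bool :=
  has (fun p => coord l.1 p <= l.2) e && has (fun p => l.2 < coord l.1 p) e.

Lemma crossesP (l : nat * int) (e : {fset Z3}) :
  reflect (exists p q, [/\ p \in e, q \in e & coord l.1 p <= l.2 < coord l.1 q])
          (crosses l e).
Proof.
apply: (iffP andP) => [[/hasP[p pe lp] /hasP[q qe lq]]|[p [q [pe qe /andP[lp lq]]]]].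
  by exists p, q; rewrite lp lq.
by split; apply/hasP; [exists p | exists q].
Qed.

(** The ends of a grid edge differ on a single axis, and there by 1, which leaves room for one gap
    only. *)
Lemma crosses_inj (p q : Z3) (l l' : nat * int) : grid_adj p q ->
  (l.1 < 3)%N -> (l'.1 < 3)%N ->
  crosses l [fset p; q]%fset -> crosses l' [fset p; q]%fset -> l = l'.
Proof.
case: p q l l' => [[a b] c] [[a' b'] c'] [i k] [j k'].
rewrite /grid_adj /L1dist /= => /eqP adj i3 j3.
move=> /crossesP[p [p' [pe p'e hp]]] /crossesP[q [q' [qe q'e hq]]].
move: pe p'e qe q'e hp hq; rewrite !inE.
move=> /orP[]/eqP-> /orP[]/eqP-> /orP[]/eqP-> /orP[]/eqP->;
case: i i3 => [|[|[|//]]] _; case: j j3 => [|[|[|//]]] _; rewrite /coord /= => hp hq;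
  solve [exfalso; lia | congr pair; lia].
Qed.

(** A discrete intermediate value theorem: the edge is the one by which the path first rises above
    level [k]. *)
Lemma path_crosses (E : {fset {fset Z3}}) (i : nat) (k : int) (u : Z3) (s : seq Z3) :
  path (joined E) u s -> coord i u <= k < coord i (last u s) ->
  exists2 e, e \in E & crosses (i, k) e.
Proof.
elim: s u => [|x s IH] u /=; first by move=> _ h; exfalso; lia.
move=> /andP[ux xs] /andP[lu lx].
have [xk|kx] := leP (coord i x) k; first by apply: (IH x xs); rewrite xk.
exists [fset u; x]%fset => //; apply/crossesP; exists u, x.
by rewrite !inE !eqxx orbT lu.
Qed.

(** Choosing for each [a] the first related [b] is injective. It will be applied with gaps for [s]
    and tree edges for [t]. *)
Lemma leq_size_rel {A B : eqType} (b0 : B) (r : A -> B -> bool) (s : seq A) (t : seq B) :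
  uniq s -> {in s, forall a, exists2 b, b \in t & r a b} ->
  {in s & s, forall a a', {in t, forall b, r a b -> r a' b -> a = a'}} ->
  (size s <= size t)%N.
Proof.
move=> us ex_r inj_r; pose f a := nth b0 t (find (r a) t).
have fP a : a \in s -> f a \in t /\ r a (f a).
  move=> /ex_r[b bt rab]; have hr : has (r a) t by apply/hasP; exists b.
  by split; [apply: mem_nth; rewrite -has_find | apply: nth_find].
rewrite -(size_map f); apply: uniq_leq_size.
  rewrite map_inj_in_uniq // => a a' sa sa' ff.
  have [ft ra] := fP a sa; have [_ ra'] := fP a' sa'.
  by apply: (inj_r a a' sa sa' (f a)); rewrite // ff.
by move=> _ /mapP[a sa ->]; have [] := fP a sa.
Qed.

Definition mincoord (u v w : Z3) (i : nat) : int :=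
  Num.min (coord i u) (Num.min (coord i v) (coord i w)).

(** The maximal level of each axis is left out, since a gap is named by its lower level. *)
Definition spread_levels (u v w : Z3) : seq (nat * int) :=
  [seq (i, mincoord u v w i + k%:Z) | i <- iota 0 3,
     k <- iota 0 `|spread (coord i u) (coord i v) (coord i w)|%N].

Lemma size_spread_levels u v w : (size (spread_levels u v w))%:Z = total_spread u v w.
Proof.
rewrite /spread_levels size_allpairs_dep /= !size_iota /total_spread /coord /= /spread.
lia.
Qed.

Lemma spread_levels_uniq u v w : uniq (spread_levels u v w).
Proof.
apply: allpairs_uniq_dep => [|i _|]; rewrite ?iota_uniq //.
move=> [i k] [j k'] _ _ /= [ij]; subst j => h; congr existT; lia.
Qed.

Lemma spread_le_connecting_tree (u v w : Z3) (n : nat) :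
  connecting_tree_size u v w n -> total_spread u v w <= n%:Z.
Proof.
move=> [V [E [[_ sub con _] uV vV wV <-]]].
rewrite -size_spread_levels; suff : (size (spread_levels u v w) <= #|` E|%fset)%N by lia.
apply: (leq_size_rel fset0 crosses); first exact: spread_levels_uniq.
  move=> l /allpairsPdep[i [k [_ ki ->]]]; move: ki; rewrite mem_iota => ki.
  (* Among the three points, [p] attains the minimum on axis [i] and [q] the maximum; the tree path
     from [p] to [q] crosses every gap between. *)
  have [p [q [pV qV pq]]] : exists p q, [/\ p \in V, q \in V
      & coord i p <= mincoord u v w i + k%:Z < coord i q].
    have [p pV ep] : exists2 p, p \in V & coord i p = mincoord u v w i.
      rewrite /mincoord; case: leP => _; first by exists u.
      by case: leP => _; [exists v | exists w].
    have [q qV eq] : exists2 q, q \in V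
        & coord i q = Num.max (coord i u) (Num.max (coord i v) (coord i w)).
      case: leP => _; last by exists u.
      by case: leP => _; [exists w | exists v].
    exists p, q; split=> //; rewrite ep eq; move: ki; rewrite /spread /mincoord; lia.
  have [s ps ls] := con p q pV qV.
  by apply: (path_crosses _ _ _ _ _ ps); rewrite ls.
move=> l l' /allpairsPdep[i [k [i3 _ ->]]] /allpairsPdep[j [k' [j3 _ ->]]] e.
move=> /sub[p [q [_ _ pq ->]]]; move: i3 j3; rewrite !mem_iota => i3 j3.
exact: (crosses_inj _ _ _ _ pq).
Qed.

Lemma tristance_spread (u v w : Z3) : (tristance u v w)%:Z = total_spread u v w.
Proof.
have [n [cn nle]] := connecting_tree_le_spread u v w.
have nE : n%:Z = total_spread u v w.
  by apply/eqP; rewrite eq_le nle spread_le_connecting_tree.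
(* The two bounds make [n] the unique minimum, so [xget] does not fall back on its default. *)
rewrite /tristance (xget_unique _ (x := n)) //.
  split=> // m /spread_le_connecting_tree; lia.
by move=> m [/spread_le_connecting_tree h /(_ n cn)]; lia.
Qed.

(** * Finiteness and the unique optimal anticode *)

Lemma finite_int_interval (a b : int) : finite_set [set x : int | a <= x <= b].
Proof.
apply: (@sub_finite_set _ _ [set` [seq a + k%:Z | k <- iota 0 `|(b - a + 1)%R|%N]]);
  last exact: finite_seq.
move=> x /= axb; apply/mapP; exists `|x - a|%N; rewrite ?mem_iota; lia.
Qed.

(** On each axis, the spread bounds the distance from [w] to [u], so [w] lies in a box around
    [u]. *)
Lemma finite_spread_le (u v : Z3) (d : int) :
  finite_set [set w | total_spread u v w <= d].
Proof.
pose I c := [set x : int | c - d <= x <= c + d].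
apply: (@sub_finite_set _ _ (I u.1.1 `*` I u.1.2 `*` I u.2)); last first.
  by do !apply: finite_setX; apply: finite_int_interval.
case=> [[x y] z]; rewrite /total_spread /spread /= /I => h.
by do !split => /=; lia.
Qed.

(** Turns maximal cardinality into equality; an infinite [B] could inject into a proper subset. *)
Lemma sub_card_le_eq {T : choiceType} (A B : set T) :
  finite_set B -> A `<=` B -> (B #<= A)%card -> A = B.
Proof.
move=> fB AB BA; have fA := sub_finite_set AB fB.
have /(fcard_eq fA fB) cE : (A #= B)%card.
  by rewrite card_eq_le BA (subset_card_le AB).
apply: (fset_set_inj fA fB); apply/eqP.
by rewrite eqEfcard cE leqnn andbT -fset_set_sub.
Qed.

Lemma optimal_anticodeE (d : int) (v1 v2 : Z3) (A : set Z3) :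
  optimal_anticode d v1 v2 A <-> A = [set v | total_spread v1 v2 v <= d].
Proof.
have anticodeE B :
    tristance_anticode d v1 v2 B <-> B `<=` [set v | total_spread v1 v2 v <= d].
  by split=> h v /h /=; rewrite tristance_spread.
split=> [[/anticodeE sub opt]|->].
  by apply: sub_card_le_eq => //; [apply: finite_spread_le | apply/opt/anticodeE].
by split=> [|B /anticodeE]; [apply/anticodeE | apply: subset_card_le].
Qed.

(** * From spreads to the 26 inequalities *)

Definition excess (lo hi c : int) : int := Num.max 0 (Num.max (lo - c) (c - hi)).

(** Here [excess] is the distance from [c] to the interval spanned by [a] and [b], by which [c]
    widens their range. *)
Lemma spread_excess a b c :
  spread a b c = `|a - b| + excess (Num.min a b) (Num.max a b) c.
Proof. rewrite /spread /excess; lia. Qed.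

Lemma excess_ge lo hi c :
  [/\ 0 <= excess lo hi c, lo - c <= excess lo hi c & c - hi <= excess lo hi c].
Proof. rewrite /excess; split; lia. Qed.

Lemma excess_cases lo hi c :
  [\/ excess lo hi c = 0, excess lo hi c = lo - c | excess lo hi c = c - hi].
Proof.
by rewrite /excess; case: leP => _; [case: leP => _; constructor | constructor].
Qed.

(** Each excess is a maximum of three terms, so the sum is at most [delta] iff all 27 sums of one
    term per axis are. The choice of three zeros is [0 <= delta]; the others are the 26
    inequalities. *)
Lemma sum_excess_le (xmin xmax ymin ymax zmin zmax x y z delta : int) :
  0 <= delta ->
  (excess xmin xmax x + excess ymin ymax y + excess zmin zmax z <= delta) =
  [&& xmin - delta <= x <= xmax + delta,
      ymin - delta <= y <= ymax + delta,
      zmin - delta <= z <= zmax + delta,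
      xmin + ymin - delta <= x + y <= xmax + ymax + delta,
      xmin - ymax - delta <= x - y <= xmax - ymin + delta,
      xmin + zmin - delta <= x + z <= xmax + zmax + delta,
      xmin - zmax - delta <= x - z <= xmax - zmin + delta,
      ymin + zmin - delta <= y + z <= ymax + zmax + delta,
      ymin - zmax - delta <= y - z <= ymax - zmin + delta,
      xmin + ymin + zmin - delta <= x + y + z <= xmax + ymax + zmax + delta,
      xmin - ymax + zmin - delta <= x - y + z <= xmax - ymin + zmax + delta,
      xmin + ymin - zmax - delta <= x + y - z <= xmax + ymax - zmin + delta
    & xmin - ymax - zmax - delta <= x - y - z <= xmax - ymin - zmin + delta].
Proof.
move=> delta0.
have [x0 xl xr] := excess_ge xmin xmax x; have [y0 yl yr] := excess_ge ymin ymax y.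
have [z0 zl zr] := excess_ge zmin zmax z.
apply/idP/idP => [le|].
  by rewrite -!andbA; do !(apply/andP; split); lia.
rewrite -!andbA.
do 25![case/andP => ?]; move=> ?.
(* Each of the 27 cases is [delta0] or one of the inequalities, up to rearrangement. *)
by case: (excess_cases xmin xmax x) => ->; case: (excess_cases ymin ymax y) => ->;
  case: (excess_cases zmin zmax z) => ->; clear x0 xl xr y0 yl yr z0 zl zr; lia.
Qed.

Theorem theorem29 (x1 y1 z1 x2 y2 z2 d : int) :
  let v1 : Z3 := (x1, y1, z1) in
  let v2 : Z3 := (x2, y2, z2) in
  v1 <> v2 ->
  L1dist v1 v2 <= d ->
  let delta := d - L1dist v1 v2 in
  let xmax := Num.max x1 x2 in
  let xmin := Num.min x1 x2 in
  let ymax := Num.max y1 y2 in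
  let ymin := Num.min y1 y2 in
  let zmax := Num.max z1 z2 in
  let zmin := Num.min z1 z2 in
  forall A : set Z3,
    optimal_anticode d v1 v2 A <->
    A = [set v : Z3 | let: (x, y, z) := v in
      [&& xmin - delta <= x <= xmax + delta,
          ymin - delta <= y <= ymax + delta,
          zmin - delta <= z <= zmax + delta,
          xmin + ymin - delta <= x + y <= xmax + ymax + delta,
          xmin - ymax - delta <= x - y <= xmax - ymin + delta,
          xmin + zmin - delta <= x + z <= xmax + zmax + delta,
          xmin - zmax - delta <= x - z <= xmax - zmin + delta,
          ymin + zmin - delta <= y + z <= ymax + zmax + delta,
          ymin - zmax - delta <= y - z <= ymax - zmin + delta,
          xmin + ymin + zmin - delta <= x + y + z
            <= xmax + ymax + zmax + delta,
          xmin - ymax + zmin - delta <= x - y + z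
            <= xmax - ymin + zmax + delta,
          xmin + ymin - zmax - delta <= x + y - z
            <= xmax + ymax - zmin + delta
        & xmin - ymax - zmax - delta <= x - y - z
            <= xmax - ymin - zmin + delta]].
Proof.
move=> v1 v2 _ v12d delta xmax xmin ymax ymin zmax zmin A.
rewrite optimal_anticodeE.
set S := [set v | _]; set S' := [set v : Z3 | let: (x, y, z) := v in _].
suff -> : S = S' by [].
have delta0 : 0 <= delta by rewrite subr_ge0.
apply/funext => -[[x y] z]; rewrite /S /S' /= -sum_excess_le //.
(* The terms [|a - b|] add up to the distance from [v1] to [v2], which [delta] subtracts from
   [d]. *)
rewrite /total_spread !spread_excess /= /delta /L1dist /=.
congr is_true; rewrite -/xmin -/xmax -/ymin -/ymax -/zmin -/zmax.
by apply/idP/idP; lia.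
Qed.
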